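(* If $G=D_{2p^2}$, where $p$ is a prime, then $R(\mathcal{B}(G))=1+p^2\sqrt{3}+\sqrt{p-1}\left(\sqrt{p+1}\,(p+1)+2p\sqrt{3p}\right)$, $\mathrm{ABC}(\mathcal{B}(G))=p^2\sqrt{6}+\sqrt{p^2-1}\left(\sqrt{p^2-2}+p\sqrt{p^4-p^2-1}\right)+p\sqrt{3p^2-3p}\left(\sqrt{3p^2-3p-1}+\sqrt{3p^4-3p^3-1}\right)$, $\mathrm{GA}(\mathcal{B}(G))=\frac{2+3p^2\sqrt{3}}{2}+\sqrt{(p^2-1)^3}\left(\frac{2}{p^2}+\frac{2p^3}{p^4-p^2+1}\right)+\sqrt{(3p^2-3p)^3}\left(\frac{2p}{3p^2-3p+1}+\frac{2p^3}{3p^4-3p^3+1}\right)$, $H(\mathcal{B}(G))=\frac{2+3p^2}{2}+(p^2-1)\left(\frac{2}{p^2}+\frac{2p^2}{p^4-p^2+1}\right)+3p^2(p-1)\left(\frac{2}{3p^2-3p+1}+\frac{2p}{3p^4-3p^3+1}\right)$ and $\mathrm{SCI}(\mathcal{B}(G))=\frac{1}{\sqrt{2}}+\frac{3p^2}{2}+(p^2-1)\left(\frac{1}{p}+\frac{p^2}{\sqrt{p^4-p^2+1}}\right)+3p^2(p-1)\left(\frac{1}{\sqrt{3p^2-3p+1}}+\frac{p}{\sqrt{3p^4-3p^3+1}}\right)$.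
   Context: $D_{2n}=\langle a,b : a^n=b^2=1,\ bab=a^{-1}\rangle$ is the dihedral group of order $2n$. For a finite group $G$, $L(G)$ denotes the set of all subgroups of $G$. The subgroup generating bipartite graph $\mathcal{B}(G)$ is the simple undirected bipartite graph whose vertex set is the disjoint union $(G\times G)\sqcup L(G)$, where $(x,y)\in G\times G$ and $H\in L(G)$ are adjacent if and only if $H=\langle x,y\rangle$ (the subgroup generated by $x$ and $y$); there are no other edges. For a finite simple graph $\mathcal{G}$ with edge set $e(\mathcal{G})$, writing $d(u)$ for the degree of $u$ in $\mathcal{G}$: the Randic Connectivity index is $R(\mathcal{G})=\sum_{uv\in e(\mathcal{G})}(d(u)d(v))^{-1/2}$; the Atom-Bond Connectivity index is $\mathrm{ABC}(\mathcal{G})=\sum_{uv\in e(\mathcal{G})}\left(\frac{d(u)+d(v)-2}{d(u)d(v)}\right)^{1/2}$; the Geometric-Arithmetic index is $\mathrm{GA}(\mathcal{G})=\sum_{uv\in e(\mathcal{G})}\frac{\sqrt{d(u)d(v)}}{\frac12(d(u)+d(v))}$; the Harmonic index is $H(\mathcal{G})=\sum_{uv\in e(\mathcal{G})}\frac{2}{d(u)+d(v)}$; the Sum-Connectivity index is $\mathrm{SCI}(\mathcal{G})=\sum_{uv\in e(\mathcal{G})}(d(u)+d(v))^{-1/2}$. *)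

(* Defs.v *)
From HB Require Import structures.
From mathcomp Require Import all_boot all_order all_algebra all_fingroup.
From mathcomp Require Import all_solvable.

Set Implicit Arguments.
Unset Strict Implicit.
Unset Printing Implicit Defensive.

Import Order.TTheory GRing.Theory Num.Theory.

Record sgraph := SGraph {
  svertex :> finType;
  sadj : rel svertex;
  sadj_sym : symmetric sadj;
  sadj_irr : irreflexive sadj }.

Definition edges (g : sgraph) : {set {set g}} :=
  [set [set uv.1; uv.2] | uv : g * g & sadj uv.1 uv.2].

Definition deg (g : sgraph) (u : g) : nat := #|[set v | sadj u v]|.

Section TopologicalIndices.
Variables (R : rcfType) (g : sgraph).
Local Open Scope ring_scope.

(* An edge [e] is a 2-element set {u, v}, so that [degprod e] is d(u) d(v) *)
(* and [degsum e] is d(u) + d(v).                                          *)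
Definition degprod (e : {set g}) : R := \prod_(u in e) (deg u)%:R.
Definition degsum (e : {set g}) : R := \sum_(u in e) (deg u)%:R.

Definition randic_index : R :=
  \sum_(e in edges g) (Num.sqrt (degprod e))^-1.

Definition ABC_index : R :=
  \sum_(e in edges g) Num.sqrt ((degsum e - 2) / degprod e).

Definition GA_index : R :=
  \sum_(e in edges g) Num.sqrt (degprod e) / (2^-1 * degsum e).

Definition harmonic_index : R :=
  \sum_(e in edges g) 2 / degsum e.

Definition SCI_index : R :=
  \sum_(e in edges g) (Num.sqrt (degsum e))^-1.

End TopologicalIndices.

Section SubgroupGeneratingBipartiteGraph.
Variable gT : finGroupType.
Local Open Scope group_scope.

Definition sgb_adj : rel ((gT * gT) + {group gT})%type := fun u v =>
  match u, v with
  | inl (x, y), inr H | inr H, inl (x, y) => H == <<[set x; y]>>%G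
  | _, _ => false
  end.

Lemma sgb_adj_sym : symmetric sgb_adj.
Proof. by move=> [[x y]|H] [[z t]|K]. Qed.

Lemma sgb_adj_irr : irreflexive sgb_adj.
Proof. by move=> [[x y]|H]. Qed.

(* The finite group is the whole type [gT], whose set of subgroups is the *)
(* finite type [{group gT}].                                              *)
Definition sgb_graph : sgraph := SGraph sgb_adj_sym sgb_adj_irr.

End SubgroupGeneratingBipartiteGraph.

Definition is_dihedral (gT : finGroupType) (n : nat) : Prop :=
  ([set: gT] \isog Grp (a : b : a ^+ n, b ^+ 2, b * a * b = a^-1))%g.

(* Main.v *)
Require Import Defs.
From HB Require Import structures.
From mathcomp Require Import all_boot all_order all_algebra all_fingroup.
From mathcomp Require Import all_solvable.
From mathcomp Require Import ring lra.

(** Each vertex (x, y) has the single neighbour <x, y>, so the edges of the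
    graph correspond to the pairs (x, y); the edge of (x, y) has degrees 1 and
    d, where d is the number of pairs generating H = <x, y> ([gen_pairs H]).
    Hence every index is a sum over all pairs of some f(d), and grouping the
    d pairs that generate the same subgroup turns it into a sum of d f(d) over
    the subgroups that occur.

    The subgroups themselves never have to be classified.  Let C be the
    rotation subgroup, of order n = p^2.  Since C has index 2, a pair (x, y)
    not inside C generates the same subgroup as a pair (r, c) with r outside C
    and c in C, and each such (r, c) arises three times, from (r, c), (c, r)
    and (r, r c) ([sum_pairs_index2]).  Elements outside C are involutions that
    invert C, so <r, c> consists of the m elements of <c> and the m elements of
    <c> r, where m = #[c]; a pair (r', c') of the same kind generates
    it exactly when r' lies in <c> r and c' generates <c>.  With the
    factor three again, <r, c> has 3 m phi(m) generating pairs
    ([card_gen_pairs_reflection]).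

    Inside C, subgroups form a chain with orders 1, p, p^2, and a pair
    of a nontrivial cyclic p-group K generates K unless it lies in the maximal
    subgroup M of K; so K has |K|^2 - |M|^2 generating pairs, and likewise |K| - |M|
    generators ([sum_pairs_cyclic], [sum_order_cyclic]).

    Together ([sum_gen_pairs_dihedral]), d takes the values 1 (once), 3 (for
    p^2 subgroups), p^2 - 1, p^2 (p^2 - 1), 3p (p - 1) (for p subgroups) and
    3p^3 (p - 1), and each formula follows by simplifying d f(d). *)

Set Implicit Arguments.
Unset Strict Implicit.
Unset Printing Implicit Defensive.

Import Order.TTheory GRing.Theory Num.Theory.
Local Open Scope ring_scope.

(** * Generating pairs and subgroups of index two *)

Definition gen_pairs (gT : finGroupType) (H : {set gT}) : {set gT * gT} :=
  [set u | <<[set u.1; u.2]>>%g == H].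

Section IndexTwo.

Variables (gT : finGroupType) (C : {group gT}).
Hypothesis cardG : #|[set: gT]| = #|C|.*2.
Local Open Scope group_scope.

Lemma mul_notin_index2 x y : x \notin C -> y \notin C -> x * y \in C.
Proof.
have index2 : #|[set: gT] : C| = 2.
  by rewrite -divgS ?subsetT // cardG -mul2n mulnK.
have coset_notin z : z \notin C -> C :* z = [set: gT] :\: C.
  move=> C'z; apply: rcoset_index2 => //; first exact: subsetT.
  by rewrite !inE C'z.
move=> C'x C'y; have C'yV : y^-1 \notin C by rewrite groupV.
by rewrite -[y]invgK -mem_rcoset coset_notin // !inE C'x.
Qed.

Lemma gen_mulg_pair (x y : gT) : <<[set x; x * y]>> = <<[set x; y]>>.
Proof.
apply/eqP; rewrite eqEsubset !gen_subG !subUset !sub1set.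
have gen1 z : x \in <<[set x; z]>> by rewrite mem_gen ?set21.
have gen2 z : z \in <<[set x; z]>> by rewrite mem_gen ?set22.
rewrite groupM ?gen1 ?gen2 //=.
by rewrite -[X in X \in _](mulKg x) groupM ?groupV ?gen1 ?gen2.
Qed.

(** The pairs (x, y) with y alone outside C are reduced to the pairs with x
    alone outside C by swapping, and those with both outside C by replacing y
    with x y, which lies in C; both moves preserve the generated subgroup.
    An arbitrary F is allowed because the lemma serves both the index sums and
    the count of generating pairs of a single subgroup. *)
Lemma sum_pairs_index2 (V : nmodType) (F : {set gT} -> V) :
  (\sum_x \sum_y F <<[set x; y]>>
   = \sum_(x in C) \sum_(y in C) F <<[set x; y]>>
     + (\sum_(x | x \notin C) \sum_(y in C) F <<[set x; y]>>) *+ 3)%R.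
Proof.
have split_row x : (\sum_y F <<[set x; y]>>
    = \sum_(y in C) F <<[set x; y]>>
      + \sum_(y | y \notin C) F <<[set x; y]>>)%R.
  by rewrite (bigID (mem C)).
rewrite (bigID (mem C)) /= !(eq_bigr _ (fun x _ => split_row x)) !big_split /=.
have -> : (\sum_(x in C) \sum_(y | y \notin C) F <<[set x; y]>>
           = \sum_(x | x \notin C) \sum_(y in C) F <<[set x; y]>>)%R.
  rewrite exchange_big; apply: eq_bigr => x _; apply: eq_bigr => y _.
  by rewrite setUC.
have -> : (\sum_(x | x \notin C) \sum_(y | y \notin C) F <<[set x; y]>>
           = \sum_(x | x \notin C) \sum_(y in C) F <<[set x; y]>>)%R.
  apply: eq_bigr => x C'x; rewrite [LHS](reindex_inj (mulgI x)) /=.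
  apply: eq_big => [y|y _]; last by rewrite gen_mulg_pair.
  apply/idP/idP => [|Cy]; last by rewrite groupMr.
  by apply: contraR; exact: mul_notin_index2.
by rewrite !mulrS mulr0n addr0 !addrA.
Qed.

Lemma card_gen_pairs (H : {set gT}) :
  (#|gen_pairs H| = \sum_x \sum_y (<<[set x; y]>> == H))%N.
Proof.
rewrite pair_big /= -sum1_card big_mkcond /=.
by apply: eq_bigr => u _; rewrite inE; case: eqP.
Qed.

(** * Subgroups generated by a reflection and a rotation *)

Hypothesis inverting : forall r, r \notin C ->
  r ^+ 2 = 1 /\ {in C, forall c, c ^ r = c^-1}.

Lemma gen_reflection_pair r c :
  r \notin C -> c \in C -> <<[set r; c]>> = <[c]> * <[r]>.
Proof.
move=> C'r Cc; rewrite -norm_joinEr; last first.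
  rewrite cycle_subG; apply/normP; rewrite -cycleJ.
  by have [_ ->] := inverting C'r; rewrite ?cycleV.
by rewrite joing_idl joing_idr setUC.
Qed.

Lemma cycle_reflection r : r \notin C -> <[r]> = [set 1; r].
Proof.
move=> C'r; have [r2 _] := inverting C'r.
apply: cycle2g; apply: nt_prime_order => //.
by apply: contraNneq C'r => ->; exact: group1.
Qed.

(** As r normalises <c> and has order 2, the subgroup is the disjoint union of
    <c> and its coset <c> r; in particular it meets C in <c> only. *)
Lemma mem_gen_reflection_pair r c z : r \notin C -> c \in C ->
  (z \in <<[set r; c]>>) = (if z \in C then z \in <[c]> else z * r \in <[c]>).
Proof.
move=> C'r Cc; have [r2 _] := inverting C'r.
have rV : r^-1 = r by apply/eqP; rewrite eq_invg_mul -(expgS r 1) r2.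
have sCc : <[c]> \subset C by rewrite cycle_subG.
rewrite gen_reflection_pair // (cycle_reflection C'r) mulgU mulg1 inE.
rewrite mem_rcoset rV; case: ifP => Cz.
  apply/orb_idr => /(subsetP sCc); rewrite groupMl // => Cr.
  by rewrite Cr in C'r.
by apply/orb_idl => /(subsetP sCc); rewrite Cz.
Qed.

(** The intersection with C recovers <c> from <r, c>, and then r matters only
    through its coset <c> r. *)
Lemma gen_reflection_pair_eq r c x y :
    r \notin C -> c \in C -> x \notin C -> y \in C ->
  (<<[set x; y]>> == <<[set r; c]>>) = (x * r \in <[c]>) && generator <[c]> y.
Proof.
move=> C'r Cc C'x Cy; rewrite /generator.
apply/eqP/andP => [eq_gen|[cxr /eqP eq_cyc]].
  have mem_eq z : z \in C -> (z \in <[y]>) = (z \in <[c]>).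
    move=> Cz; move: (mem_gen_reflection_pair z C'x Cy).
    by rewrite eq_gen mem_gen_reflection_pair // Cz.
  split.
    have := mem_gen_reflection_pair x C'r Cc.
    by rewrite (negPf C'x) -eq_gen mem_gen ?inE ?eqxx.
  have sC z : z \in C -> <[z]> \subset C by rewrite cycle_subG.
  apply/eqP/setP=> z; apply/idP/idP => cz.
    by rewrite mem_eq ?(subsetP (sC _ Cc)).
  by rewrite -mem_eq ?(subsetP (sC _ Cy)).
have [r2 _] := inverting C'r.
have x_def : x = x * r * r by rewrite -mulgA -(expgS r 1) r2 mulg1.
rewrite !gen_reflection_pair // -eq_cyc.
rewrite (cycle_reflection C'r) (cycle_reflection C'x) !mulgU !mulg1.
by rewrite [in LHS]x_def rcosetM (rcoset_id cxr).
Qed.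

(** [sum_pairs_index2] for the indicator of a subgroup: no pair inside C
    generates it, and among the pairs (x, y) with only y in C it is generated
    by those with x in <c> r and y a generator of <c>. *)
Lemma card_gen_pairs_reflection r c : r \notin C -> c \in C ->
  #|gen_pairs <<[set r; c]>>| = (3 * (#[c] * totient #[c]))%N.
Proof.
move=> C'r Cc; have [r2 _] := inverting C'r.
have sCc : <[c]> \subset C by rewrite cycle_subG.
rewrite card_gen_pairs (sum_pairs_index2 (fun K => (K == _) : nat)).
rewrite [X in (X + _)%R]big1 => [|x Cx]; last first.
  apply: big1 => y Cy; case: eqP => // eq_gen; case/negP: C'r.
  have: <<[set x; y]>> \subset C by rewrite gen_subG subUset !sub1set Cx.
  by rewrite eq_gen => /subsetP->; rewrite ?mem_gen ?inE ?eqxx.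
rewrite add0r -[LHS]mulr_natl; congr (_ * _)%N.
(* The factor #[c] is read as the size of the coset <[c]> * r. *)
rewrite totient_gen -[#[c]](card_imset _ (mulIg r)) -!sum1_card.
rewrite big_distrlr /= big_mkcond [RHS]big_mkcond; apply: eq_bigr => x _ /=.
have -> : (x \in [set z * r | z in <[c]>]) = (x \notin C) && (x * r \in <[c]>).
  apply/imsetP/andP=> [[z cz ->]|[C'x cxr]].
    split; last by rewrite -mulgA -(expgS r 1) r2 mulg1.
    by rewrite groupMl ?(subsetP sCc z cz).
  by exists (x * r); rewrite // -mulgA -(expgS r 1) r2 mulg1.
case: (boolP (x \in C)) => //= C'x.
case: ifP => cxr; last first.
  by apply: big1 => y Cy; rewrite gen_reflection_pair_eq // cxr.
rewrite big_mkcond [RHS]big_mkcond; apply: eq_bigr => y _ /=; rewrite inE.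
case: ifP => Cy; first by rewrite gen_reflection_pair_eq // cxr; case: ifP.
by case: ifP => // /cycle_generator/(subsetP sCc); rewrite Cy.
Qed.

End IndexTwo.

(** * Cyclic groups of prime power order *)

Section CyclicPrimePower.

Variables (gT : finGroupType) (p k : nat) (K M : {group gT}).
Hypotheses (p_prime : prime p) (cycK : cyclic K) (sMK : M \subset K).
Hypotheses (cardK : #|K| = (p ^ k.+1)%N) (cardM : #|M| = (p ^ k)%N).
Local Open Scope group_scope.

(** Subgroups of a cyclic group are ordered by divisibility of their orders,
    and a proper divisor of p ^ k.+1 divides p ^ k. *)
Lemma sub_maximal_cyclic (H : {group gT}) :
  H \subset K -> (H \subset M) = (H != K :> {set gT}).
Proof.
move=> sHK; rewrite -(cardSg_cyclic cycK) // eqEcard sHK cardK cardM /=.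
have := cardSg sHK; rewrite cardK => /(dvdn_pfactor _ _ p_prime)[m le_m ->].
rewrite dvdn_Pexp2l ?leq_exp2l ?prime_gt1 // -ltnNge.
by rewrite ltnS.
Qed.

Lemma gen_pairs_maximal_cyclic : setX K K :\: setX M M = gen_pairs K.
Proof.
apply/setP=> -[x y]; rewrite !inE /=.
case: (boolP ((x \in K) && (y \in K))) => [Kxy|]; last first.
  rewrite andbF => K'xy; apply/esym/(contraNF _ K'xy) => /eqP <-.
  by rewrite !mem_gen ?inE ?eqxx ?orbT.
have sgenK : <<[set x; y]>> \subset K by rewrite gen_subG subUset !sub1set.
rewrite andbT -[RHS]negbK -(sub_maximal_cyclic sgenK).
by rewrite gen_subG subUset !sub1set.
Qed.

Lemma card_gen_pairs_cyclic : #|gen_pairs K| = (#|K| ^ 2 - #|M| ^ 2)%N.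
Proof.
rewrite -gen_pairs_maximal_cyclic cardsD (setIidPr _) ?cardsX ?mulnn //.
by apply/subsetP=> u; rewrite !inE => /andP[/(subsetP sMK)-> /(subsetP sMK)->].
Qed.

(** One step down the chain of subgroups of a cyclic p-group: outside M every
    pair generates K. *)
Lemma sum_pairs_cyclic (V : nmodType) (F : {set gT} -> V) :
  (\sum_(u in setX K K) F <<[set u.1; u.2]>>
   = \sum_(u in setX M M) F <<[set u.1; u.2]>> + F K *+ #|gen_pairs K|)%R.
Proof.
rewrite (big_setID (setX M M)) gen_pairs_maximal_cyclic (setIidPr _) /=.
  congr (_ + _)%R; rewrite -sumr_const; apply: eq_bigr => u.
  by rewrite inE => /eqP->.
by apply/subsetP=> u; rewrite !inE => /andP[/(subsetP sMK)-> /(subsetP sMK)->].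
Qed.

(** The analogue of [sum_pairs_cyclic] for single elements: outside M every
    element generates K. *)
Lemma sum_order_cyclic (V : nmodType) (g : nat -> V) :
  (\sum_(c in K) g #[c]
   = \sum_(c in M) g #[c] + g #|K| *+ (#|K| - #|M|))%R.
Proof.
rewrite (big_setID M) (setIidPr sMK) /=; congr (_ + _)%R.
have -> : (#|K| - #|M|)%N = #|K :\: M| by rewrite cardsD (setIidPr sMK).
rewrite -sumr_const; apply: eq_bigr => c; rewrite inE => /andP[M'c Kc].
congr (g _); have: <[c]> == K :> {set gT}; last by move=> /eqP <-.
by rewrite -[_ == _]negbK -sub_maximal_cyclic ?cycle_subG.
Qed.

End CyclicPrimePower.

(** * The dihedral group *)

(** The presentation is equivalent to the one of ['D_n.*2], which gives the
    order 2n; as the group is the product of <a> and <b>, of orders at most n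
    and 2, these orders must be exactly n and 2.  An element outside <a> then
    has the form c b with c in <a>; it inverts <a> because b does, and its
    square is c (b c b) = c c^-1 = 1. *)
Lemma dihedral_structure (gT : finGroupType) (n : nat) :
    (1 < n)%N -> is_dihedral gT n ->
  exists2 a : gT, #[a]%g = n /\ #|[set: gT]| = n.*2
    & forall r, r \notin <[a]>%g ->
        (r ^+ 2 = 1 /\ {in <[a]>, forall c, c ^ r = c^-1})%g.
Proof.
move=> n_gt1 isoD.
have homgE rT (H : {group rT}) :
    (H \homg [set: gT] = (H \homg [set: 'D_n.*2]))%g.
  rewrite isoD Grp_dihedral //; apply: eq_existsb => -[x y] /=.
  rewrite !xpair_eqE; congr (_ && (_ && _)); apply: andb_id2l => /eqP y2.
  have yV : (y^-1 = y)%g by apply/eqP; rewrite eq_invg_mul -(expgS y 1) y2.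
  by rewrite /conjg yV mulgA.
have cardG : #|[set: gT]| = n.*2.
  rewrite -(card_dihedral n_gt1); apply/eqP; rewrite eqn_dvd.
  have := homgE _ [set: gT]%G; have := homgE _ [set: 'D_n.*2]%G.
  by rewrite !homg_refl => /card_homg-> /esym/card_homg->.
have [a [b [genG an b2 ab]]] : exists a, exists b : gT,
    [/\ <[a]> <*> <[b]> = [set: gT], a ^+ n = 1, b ^+ 2 = 1 & a ^ b = a^-1]%g.
  have := homgE _ [set: gT]%G; rewrite homg_refl Grp_dihedral //.
  move=> /esym/existsP[[a b]] /=; rewrite !xpair_eqE.
  by case/and4P=> /eqP gen /eqP an /eqP b2 /eqP ab; exists a, b.
have inv_b c : (c \in <[a]> -> c ^ b = c^-1)%g.
  by case/cycleP=> i ->; rewrite conjXg ab expgVn.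
have norm_b : (<[b]> \subset 'N(<[a]>))%g.
  by rewrite cycle_subG; apply/normP; rewrite -cycleJ ab cycleV.
have defG : (<[a]> * <[b]> = [set: gT])%g by rewrite -norm_joinEr.
have le_a : (#[a]%g <= n)%N by rewrite dvdn_leq ?order_dvdn ?an // ltnW.
have le_b : (#[b]%g <= 2)%N by rewrite dvdn_leq ?order_dvdn ?b2.
have le_ab : (n * 2 <= #[a]%g * #[b]%g)%N.
  rewrite muln2 -cardG -defG /order mul_cardG leq_pmulr // cardG_gt0.
have ord_a : #[a]%g = n.
  apply/eqP; rewrite eqn_leq le_a -(leq_pmul2r (isT : 0 < 2)%N).
  by rewrite (leq_trans le_ab) // leq_mul2l le_b orbT.
have ord_b : #[b]%g = 2%N.
  apply/eqP; rewrite eqn_leq le_b -(leq_pmul2l (ltnW n_gt1)).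
  by rewrite (leq_trans le_ab) // leq_mul2r le_a orbT.
exists a => // r a'r.
have : (r \in <[a]> * <[b]>)%g by rewrite defG inE.
case/mulsgP=> c z ac; rewrite (cycle2g ord_b) !inE.
case/orP=> /eqP-> r_def; first by case/negP: a'r; rewrite r_def mulg1.
split=> [|d ad]; last first.
  rewrite r_def conjgM [(d ^ c)%g]conjgE.
  by rewrite [(d * c)%g](centsP (cycle_abelian a)) // mulKg inv_b.
have bV : (b^-1 = b)%g by apply/eqP; rewrite eq_invg_mul -(expgS b 1) b2.
rewrite r_def expgS expg1 -mulgA -{1}bV (mulgA b^-1)%g.
by rewrite -[(b^-1 * c * b)%g]mulgA -conjgE inv_b ?mulgV.
Qed.

(** The first three terms come from the pairs inside the rotation subgroup.
    The others come from the pairs (r, c) with c of order 1, p and p ^ 2; the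
    factor p ^ 2 counts the reflections r, and the factor 3 is that of
    [sum_pairs_index2]. *)
Lemma sum_gen_pairs_dihedral (V : nmodType) (f : nat -> V) (gT : finGroupType)
    (p : nat) : prime p -> is_dihedral gT (p ^ 2)%N ->
  \sum_(u : gT * gT) f #|gen_pairs <<[set u.1; u.2]>>%g|
  = f 1%N + f (p ^ 2 - 1)%N *+ (p ^ 2 - 1)
    + f (p ^ 4 - p ^ 2)%N *+ (p ^ 4 - p ^ 2)
    + (f 3%N + f (3 * (p * p.-1))%N *+ p.-1
       + f (3 * (p ^ 2 * (p * p.-1)))%N *+ (p * p.-1)) *+ (3 * p ^ 2).
Proof.
move=> p_pr isoD; have p_gt1 := prime_gt1 p_pr; have p_gt0 := prime_gt0 p_pr.
have [a [ord_a cardG] inverting] :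
    exists2 a : gT, #[a]%g = (p ^ 2)%N /\ #|[set: gT]| = (p ^ 2).*2
    & forall r, r \notin <[a]>%g ->
        (r ^+ 2 = 1 /\ {in <[a]>, forall c, c ^ r = c^-1})%g.
  by apply: dihedral_structure; rewrite // (ltn_exp2l 0).
pose C := <[a]>%G; pose M := <[(a ^+ p)%g]>%G.
have cardC : #|C| = (p ^ 2)%N := ord_a.
have cardM : #|M| = (p ^ 1)%N.
  by rewrite [LHS](orderXdiv _) ord_a ?dvdn_mulr // expnS mulKn.
have sMC : M \subset C by exact: cycleX.
have cycC : cyclic C := cycle_cyclic a.
have cycM : cyclic M := cycle_cyclic _.
have s1M : 1%G \subset M := sub1G M.
have card1 : #|(1%G : {group gT})| = (p ^ 0)%N by rewrite cards1.
rewrite -cardC in cardG.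
have := sum_pairs_index2 cardG (fun H => f #|gen_pairs H|).
rewrite pair_big => ->; congr (_ + _).
  pose F (H : {set gT}) := f #|gen_pairs H|.
  transitivity (\sum_(u in setX C C) F <<[set u.1; u.2]>>%g).
    by rewrite pair_big; apply: eq_bigl => u; rewrite inE.
  rewrite (sum_pairs_cyclic p_pr cycC sMC cardC cardM).
  rewrite (sum_pairs_cyclic p_pr cycM s1M cardM card1) /F.
  rewrite (card_gen_pairs_cyclic p_pr cycC sMC cardC cardM).
  rewrite (card_gen_pairs_cyclic p_pr cycM s1M cardM card1).
  rewrite cardC cardM card1 -!expnM /=; congr (_ + _ + _).
  rewrite (big_pred1 (1%g, 1%g)) => [|[x y]]; last by rewrite !inE xpair_eqE.
  rewrite /= setUid genGid; congr (f _); apply/eqP/cards1P; exists (1%g, 1%g).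
  apply/setP=> -[x y]; rewrite !inE eqEsubset sub1G andbT.
  by rewrite gen_subG subUset !sub1set !inE xpair_eqE.
rewrite [(3 * p ^ 2)%N]mulnC mulrnA; congr (_ *+ _).
have order_sum : \sum_(c in C) f (3 * (#[c]%g * totient #[c]%g))%N
    = f 3%N + f (3 * (p * p.-1))%N *+ p.-1
       + f (3 * (p ^ 2 * (p * p.-1)))%N *+ (p * p.-1).
  pose h n := f (3 * (n * totient n))%N.
  rewrite (sum_order_cyclic p_pr cycC sMC cardC cardM h).
  rewrite (sum_order_cyclic p_pr cycM s1M cardM card1 h) big_set1 order1 /h.
  rewrite cardC cardM card1 !totient_pfactor // !muln1.
  congr (_ + _ *+ _ + _ *+ _); first by rewrite expn1 subn1.
    by rewrite expn1 [(p.-1 * p)%N]mulnC.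
  by rewrite -subn1 mulnBr muln1 mulnn.
rewrite (eq_bigr (fun=> \sum_(c in C) f (3 * (#[c]%g * totient #[c]%g))%N)).
  rewrite order_sum sumr_const; congr (_ *+ _).
  apply: (@addnI #|C|); rewrite cardC addnn.
  by rewrite -cardC -cardG cardsT -(fintype.cardC (mem C)).
move=> r C'r; apply: eq_bigr => c Cc.
by rewrite (card_gen_pairs_reflection cardG inverting).
Qed.

(** * Edges and degrees of the subgroup generating bipartite graph *)

Section GraphSums.

Variable gT : finGroupType.
Let B := sgb_graph gT.

Definition sgb_edge (u : gT * gT) : {set B} :=
  [set (inl u : B); inr <<[set u.1; u.2]>>%G].

(** An edge contains exactly one vertex that is a pair, and that pair
    determines its only neighbour. *)
Lemma sum_edges_sgb (V : nmodType) (F : {set B} -> V) :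
  \sum_(e in edges B) F e = \sum_u F (sgb_edge u).
Proof.
have inj_edge : injective sgb_edge.
  move=> u v /setP/(_ (inl u)); rewrite !inE eqxx /= orbF.
  by move=> /esym/eqP[].
have -> : edges B = sgb_edge @: [set: gT * gT].
  apply/setP=> e; apply/imsetP/imsetP => [[[x y]]|[u _ ->]].
    rewrite inE /=; case: x y => [[x1 x2]|H] [[y1 y2]|K] //= /eqP-> ->.
      by exists (x1, x2); rewrite ?inE.
    by exists (y1, y2); rewrite ?inE // setUC.
  exists ((inl u : B), (inr <<[set u.1; u.2]>>%G : B)) => //.
  by rewrite inE /=; case: u.
rewrite big_imset /= => [|u v _ _]; last exact: inj_edge.
by apply: eq_bigl => u; rewrite inE.
Qed.

Lemma deg_pair u : deg (inl u : B) = 1%N.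
Proof.
apply/eqP/cards1P; exists (inr <<[set u.1; u.2]>>%G).
by case: u => x y; apply/setP=> -[v|H]; rewrite !inE.
Qed.

Lemma deg_subgroup (H : {group gT}) : deg (inr H : B) = #|gen_pairs H|.
Proof.
rewrite -(card_imset _ (@inl_inj _ {group gT})); apply: eq_card => v.
rewrite !inE; apply/idP/imsetP => [|[u]]; last first.
  rewrite inE => /eqP eqH ->; case: u eqH => x y /= eqH.
  by rewrite -val_eqE /= eqH.
case: v => [[x y]|//] /= /eqP->; exists (x, y) => //.
by rewrite inE.
Qed.

Lemma degprod_sgb (R : rcfType) u :
  degprod R (sgb_edge u) = #|gen_pairs <<[set u.1; u.2]>>%g|%:R.
Proof.
by rewrite /degprod big_setU1 ?inE // big_set1 deg_pair deg_subgroup /= mul1r.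
Qed.

Lemma degsum_sgb (R : rcfType) u :
  degsum R (sgb_edge u) = 1 + #|gen_pairs <<[set u.1; u.2]>>%g|%:R.
Proof.
by rewrite /degsum big_setU1 ?inE // big_set1 deg_pair deg_subgroup.
Qed.

End GraphSums.

(** * The topological indices *)

(** [sum_gen_pairs_dihedral] with equal terms collected: a subgroup with d
    generating pairs contributes d * f d in total.  The function g stands for
    the simplified form of d * f d that each index calls for. *)
Lemma sum_sgb_dihedral (R : rcfType) (gT : finGroupType) (p : nat)
    (f g : R -> R) : prime p -> is_dihedral gT (p ^ 2)%N ->
    (forall d, 0 < d -> d * f d = g d) ->
  let q : R := p%:R in
  \sum_(u : gT * gT) f #|gen_pairs <<[set u.1; u.2]>>%g|%:R
  = g 1 + q ^+ 2 * g 3 + g (q ^+ 2 - 1) + g (q ^+ 2 * (q ^+ 2 - 1))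
    + q * g (3 * q ^+ 2 - 3 * q) + g (q ^+ 2 * (3 * q ^+ 2 - 3 * q)).
Proof.
move=> p_pr isoD fg q.
rewrite (sum_gen_pairs_dihedral (fun d => f d%:R) p_pr isoD).
have q_gt1 : 1 < q by rewrite ltr1n prime_gt1.
have q_pred : p.-1%:R = q - 1 by rewrite -subn1 natrB ?prime_gt0.
have p2_gt0 : (0 < p ^ 2)%N by rewrite expn_gt0 prime_gt0.
have le_p24 : (p ^ 2 <= p ^ 4)%N by rewrite leq_pexp2l ?prime_gt0.
rewrite !mulrnDl -!mulrnA -!(mulr_natl (f _)) !(natrM, natrB, natrX) //.
rewrite -/q q_pred.
have -> : q ^+ 4 - q ^+ 2 = q ^+ 2 * (q ^+ 2 - 1) by ring.
have -> : 3 * (q ^+ 2 * (q * (q - 1))) = q ^+ 2 * (3 * q ^+ 2 - 3 * q) by ring.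
have -> : 3 * (q * (q - 1)) = 3 * q ^+ 2 - 3 * q by ring.
have q_gt0 : 0 < q by lra.
have q2_gt0 : 0 < q ^+ 2 by rewrite exprn_gt0.
have S_gt0 : 0 < q ^+ 2 - 1 by nra.
have T_gt0 : 0 < 3 * q ^+ 2 - 3 * q by nra.
by rewrite -!fg ?mulr_gt0 //; ring.
Qed.

Theorem theorem4p5 (R : rcfType) (p : nat) (gT : finGroupType)
    (p_prime : prime p) (gT_dihedral : is_dihedral gT (p ^ 2)%N) :
  let q : R := p%:R in
  let B : sgraph := sgb_graph gT in
  [/\ randic_index R B
      = 1 + q ^+ 2 * Num.sqrt 3
        + Num.sqrt (q - 1)
          * (Num.sqrt (q + 1) * (q + 1) + 2 * q * Num.sqrt (3 * q)),
      ABC_index R B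
      = q ^+ 2 * Num.sqrt 6
        + Num.sqrt (q ^+ 2 - 1)
          * (Num.sqrt (q ^+ 2 - 2) + q * Num.sqrt (q ^+ 4 - q ^+ 2 - 1))
        + q * Num.sqrt (3 * q ^+ 2 - 3 * q)
          * (Num.sqrt (3 * q ^+ 2 - 3 * q - 1)
             + Num.sqrt (3 * q ^+ 4 - 3 * q ^+ 3 - 1)),
      GA_index R B
      = (2 + 3 * q ^+ 2 * Num.sqrt 3) / 2
        + Num.sqrt ((q ^+ 2 - 1) ^+ 3)
          * (2 / q ^+ 2 + 2 * q ^+ 3 / (q ^+ 4 - q ^+ 2 + 1))
        + Num.sqrt ((3 * q ^+ 2 - 3 * q) ^+ 3)
          * (2 * q / (3 * q ^+ 2 - 3 * q + 1)
             + 2 * q ^+ 3 / (3 * q ^+ 4 - 3 * q ^+ 3 + 1)),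
      harmonic_index R B
      = (2 + 3 * q ^+ 2) / 2
        + (q ^+ 2 - 1) * (2 / q ^+ 2 + 2 * q ^+ 2 / (q ^+ 4 - q ^+ 2 + 1))
        + 3 * q ^+ 2 * (q - 1)
          * (2 / (3 * q ^+ 2 - 3 * q + 1)
             + 2 * q / (3 * q ^+ 4 - 3 * q ^+ 3 + 1))
    & SCI_index R B
      = 1 / Num.sqrt 2 + 3 * q ^+ 2 / 2
        + (q ^+ 2 - 1) * (1 / q + q ^+ 2 / Num.sqrt (q ^+ 4 - q ^+ 2 + 1))
        + 3 * q ^+ 2 * (q - 1)
          * (1 / Num.sqrt (3 * q ^+ 2 - 3 * q + 1)
             + q / Num.sqrt (3 * q ^+ 4 - 3 * q ^+ 3 + 1)) ].
Proof.
move=> q B; have q_gt1 : 1 < q by rewrite ltr1n prime_gt1.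
have index_sum (f g : R -> R) (gE : forall d, 0 < d -> d * f d = g d) :=
  sum_sgb_dihedral p_prime gT_dihedral gE.
have sqrt_sqr (d : R) : 0 <= d -> Num.sqrt d * Num.sqrt d = d.
  by move=> d_ge0; rewrite -expr2 sqr_sqrtr.
have sqrt_gt0 (d : R) : 0 < d -> 0 < Num.sqrt d by rewrite sqrtr_gt0.
have sqrtMsq (d : R) : Num.sqrt (q ^+ 2 * d) = q * Num.sqrt d.
  by rewrite sqrtrM ?exprn_ge0 ?sqrtr_sqr ?gtr0_norm //; lra.
have q_gt0 : 0 < q by lra.
have q2_gt0 : 0 < q ^+ 2 by rewrite exprn_gt0.
have S_gt0 : 0 < q ^+ 2 - 1 by nra.
have T_gt0 : 0 < 3 * q ^+ 2 - 3 * q by nra.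
have sqrtS : Num.sqrt (q ^+ 2 - 1) = Num.sqrt (q - 1) * Num.sqrt (q + 1).
  by rewrite -sqrtrM ?subr_ge0 ?ltW //; congr Num.sqrt; ring.
have sqrtT : Num.sqrt (3 * q ^+ 2 - 3 * q)
             = Num.sqrt (q - 1) * Num.sqrt (3 * q).
  by rewrite -sqrtrM ?subr_ge0 ?ltW //; congr Num.sqrt; ring.
have denominators_neq0 :
    [&& 3 * q ^+ 4 - 3 * q ^+ 3 + 1 != 0, 3 * q ^+ 2 - 3 * q + 1 != 0,
        q ^+ 4 - q ^+ 2 + 1 != 0, q != 0 & 1 + (q ^+ 2 - 1) != 0].
  have q2S_gt0 := mulr_gt0 q2_gt0 S_gt0.
  have q2T_gt0 := mulr_gt0 q2_gt0 T_gt0.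
  by apply/and5P; split; rewrite gt_eqF //; lra.
split.
- rewrite /randic_index sum_edges_sgb.
  under eq_bigr do rewrite degprod_sgb.
  rewrite (index_sum (fun d => (Num.sqrt d)^-1) Num.sqrt); last first.
    move=> d d_gt0; rewrite -{1}(sqrt_sqr d) ?ltW // mulfK //.
    by rewrite gt_eqF ?sqrt_gt0.
  rewrite -/q !sqrtMsq sqrtr1 sqrtS sqrtT; ring.
- rewrite /ABC_index sum_edges_sgb.
  under eq_bigr do rewrite degprod_sgb degsum_sgb.
  rewrite (index_sum (fun d => Num.sqrt ((1 + d - 2) / d))
                     (fun d => Num.sqrt d * Num.sqrt (d - 1))); last first.
    move=> d d_gt0; rewrite -{1}(gtr0_norm d_gt0) -sqrtr_sqr.
    rewrite -!sqrtrM ?sqr_ge0 ?ltW //; congr Num.sqrt; field.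
    by rewrite gt_eqF.
  rewrite -/q !sqrtMsq subrr sqrtr0 -sqrtrM ?ler0n //.
  have -> : q ^+ 2 * (q ^+ 2 - 1) - 1 = q ^+ 4 - q ^+ 2 - 1 by ring.
  have -> : q ^+ 2 * (3 * q ^+ 2 - 3 * q) - 1 = 3 * q ^+ 4 - 3 * q ^+ 3 - 1.
    by ring.
  have -> : q ^+ 2 - 1 - 1 = q ^+ 2 - 2 by ring.
  have -> : 3 * (3 - 1) = 6 :> R by ring.
  ring.
- rewrite /GA_index sum_edges_sgb.
  under eq_bigr do rewrite degprod_sgb degsum_sgb.
  rewrite (index_sum (fun d => Num.sqrt d / (2^-1 * (1 + d)))
                     (fun d => 2 * d * Num.sqrt d / (1 + d))); last first.
    by move=> d d_gt0; field; rewrite gt_eqF // ltr_pwDl ?ltW.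
  have sqrt_cube (d : R) : 0 < d -> Num.sqrt (d ^+ 3) = d * Num.sqrt d.
    move=> d_gt0; rewrite -{2}(gtr0_norm d_gt0) -sqrtr_sqr -sqrtrM ?sqr_ge0 //.
    by congr Num.sqrt; ring.
  rewrite -/q !sqrtMsq sqrtr1 !sqrt_cube //.
  field; exact: denominators_neq0.
- rewrite /harmonic_index sum_edges_sgb.
  under eq_bigr do rewrite degsum_sgb.
  rewrite (index_sum (fun d => 2 / (1 + d)) (fun d => d * (2 / (1 + d)))) //.
  rewrite -/q; field; exact: denominators_neq0.
- rewrite /SCI_index sum_edges_sgb.
  under eq_bigr do rewrite degsum_sgb.
  rewrite (index_sum (fun d => (Num.sqrt (1 + d))^-1)
                     (fun d => d / Num.sqrt (1 + d))) //.
  rewrite -/q.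
  have -> : 1 + (q ^+ 2 - 1) = q ^+ 2 by ring.
  have -> : 1 + 3 = 2 ^+ 2 :> R by ring.
  rewrite !sqrtr_sqr !gtr0_norm //.
  have -> : 1 + q ^+ 2 * (q ^+ 2 - 1) = q ^+ 4 - q ^+ 2 + 1 by ring.
  have -> : 1 + q ^+ 2 * (3 * q ^+ 2 - 3 * q) = 3 * q ^+ 4 - 3 * q ^+ 3 + 1.
    by ring.
  rewrite [1 + (3 * _ - _)]addrC.
  ring.
Qed.
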